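(* Fix $M>1$, $M_1>0$ and let $\mathfrak C=\mathfrak C(M,M_1)$. Let $K:\mathbb R\to[0,\infty)$ be a bounded kernel with support contained in $[-1,1]$, $\int K(x)\,dx=1$, $\int xK(x)\,dx=0$ and $\int x^2K(x)\,dx>0$. Given i.i.d. observations $(U_1,V_1),\dots,(U_n,V_n)$ from a copula $C\in\mathfrak C$ and a bandwidth $h>0$, let $c_n(u,v)=\frac{1}{nh^2}\sum_{i=1}^nK\big(\frac{u-U_i}{h}\big)K\big(\frac{v-V_i}{h}\big)$ and define the plug-in estimator $\widehat{Ccor}=\int_0^1\int_0^1[1-c_n(u,v)]_+\,du\,dv$. Then there exist finite constants $A,B,M_5>0$ and $h_0>0$, depending only on $M$, $M_1$ and $K$, such that for all $n\ge1$ and all $h\in(0,h_0]$, $$\sup_{C\in\mathfrak C}E\big[|\widehat{Ccor}-Ccor(C)|\big]\le A\,h+\frac{B}{\sqrt{nh^2}}+\frac{M_5}{nh^2}.$$ Consequently, if $h=h_n\to0$ and $nh_n^2\to\infty$, $\widehat{Ccor}$ is uniformly consistent over $\mathfrak C$, and with $h=n^{-1/4}$ the uniform risk is $O(n^{-1/4})$.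
   Context: A copula is a probability distribution on $[0,1]^2$ with uniform marginals. For $M>1$ and $M_1>0$, $\mathfrak C(M,M_1)$ is the class of absolutely continuous copulas $C$ whose density $c$ is continuous on $(0,1)^2$ and satisfies: with $A_M=\{(u,v): c(u,v)<M\}$, $|c(u_1,v_1)-c(u_2,v_2)|\le M_1\|(u_1-u_2,v_1-v_2)\|$ whenever both points lie in $A_M$. The copula correlation is $Ccor(C)=\tfrac12\iint_{[0,1]^2}|c(u,v)-1|\,du\,dv$ (equivalently $\iint_{[0,1]^2}[1-c(u,v)]_+\,du\,dv$). Here $x_+=\max(x,0)$. *)

(* Defs.v *)
From HB Require Import structures.
From mathcomp Require Import all_boot all_order all_algebra.
From mathcomp Require Import all_classical all_reals all_analysis.
Set Implicit Arguments. Unset Strict Implicit. Unset Printing Implicit Defensive.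
Import Order.TTheory GRing.Theory Num.Theory numFieldNormedType.Exports.
Local Open Scope classical_set_scope.
Local Open Scope ring_scope.

Section Defs.
Variable R : realType.

Definition leb2 := ((@lebesgue_measure R) \x (@lebesgue_measure R))%E.

Definition unit_sq : set (R * R) := `[0, 1] `*` `[0, 1].
Definition rect (a b : R) : set (R * R) := `[0, a] `*` `[0, b].
Definition open_unit_sq : set (R * R) := `]0, 1[ `*` `]0, 1[.

Definition dist2 (p q : R * R) : R :=
  Num.sqrt ((p.1 - q.1) ^+ 2 + (p.2 - q.2) ^+ 2).

Definition copula_density (c : R * R -> R) : Prop :=
  measurable_fun setT c /\
  (forall p, 0 <= c p) /\
  (forall a : R, 0 <= a <= 1 ->
     (\int[leb2]_(p in rect a 1) (c p)%:E = a%:E)%E) /\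
  (forall a : R, 0 <= a <= 1 ->
     (\int[leb2]_(p in rect 1 a) (c p)%:E = a%:E)%E).

Definition copula_class (M M1 : R) (c : R * R -> R) : Prop :=
  copula_density c /\
  {within open_unit_sq, continuous c} /\
  (forall p q, open_unit_sq p -> open_unit_sq q -> c p < M -> c q < M ->
     `|c p - c q| <= M1 * dist2 p q).

Definition Ccor (c : R * R -> R) : \bar R :=
  ((1 / 2)%:E * \int[leb2]_(p in unit_sq) (`|c p - 1|)%:E)%E.

Definition kernel_ok (K : R -> R) : Prop :=
  measurable_fun setT K /\
  (forall x, 0 <= K x) /\
  (exists b : R, forall x, K x <= b) /\
  (forall x, 1 < `|x| -> K x = 0) /\
  (\int[@lebesgue_measure R]_x (K x)%:E = 1)%E /\
  (\int[@lebesgue_measure R]_x (x * K x)%:E = 0)%E /\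
  (0 < \int[@lebesgue_measure R]_x (x ^+ 2 * K x)%:E)%E.

Definition kde (K : R -> R) (n : nat) (h : R) (s : 'I_n -> R * R)
    (p : R * R) : R :=
  (n%:R * h ^+ 2)^-1 *
  \sum_(i < n) K ((p.1 - (s i).1) / h) * K ((p.2 - (s i).2) / h).

Definition Ccor_hat (K : R -> R) (n : nat) (h : R) (s : 'I_n -> R * R)
    : \bar R :=
  (\int[leb2]_(p in unit_sq) (Num.max (1 - kde K h s p) 0)%:E)%E.

Definition iid_copula_sample (d : measure_display) (T : measurableType d)
    (P : probability T R) (n : nat) (X : 'I_n -> T -> R * R)
    (c : R * R -> R) : Prop :=
  (forall i, measurable_fun setT (X i)) /\
  (forall i (B : set (R * R)), measurable B ->
     P (X i @^-1` B) = (\int[leb2]_(p in B `&` unit_sq) (c p)%:E)%E) /\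
  (forall B : 'I_n -> set (R * R), (forall i, measurable (B i)) ->
     P (\bigcap_i (X i @^-1` B i)) =
       (\prod_(i < n) fine (P (X i @^-1` B i)))%:E).

(* sup_{C in class} E|Ccor_hat - Ccor(C)| <= r  (the supremum also ranges
   over all probability spaces carrying such an i.i.d. sample) *)
Definition unif_risk_le (M M1 : R) (K : R -> R) (n : nat) (h r : R) : Prop :=
  forall (c : R * R -> R), copula_class M M1 c ->
  forall (d : measure_display) (T : measurableType d) (P : probability T R)
         (X : 'I_n -> T -> R * R),
  iid_copula_sample P X c ->
  (\int[P]_w `| Ccor_hat K h (fun i => X i w) - Ccor c | <= r%:E)%E.

End Defs.

(* Main.v *)
Require Import Defs.
From HB Require Import structures.
From mathcomp Require Import all_boot all_order all_algebra.
From mathcomp Require Import all_classical all_reals all_analysis.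
From mathcomp Require Import measurable_realfun ring lra.
Import Order.TTheory GRing.Theory Num.Theory numFieldNormedType.Exports.
Local Open Scope classical_set_scope.
Local Open Scope ring_scope.

(* The estimator only sees the density through x |-> (1 - x)_+, which is
   1-Lipschitz, takes values in [0, 1] for nonnegative x and vanishes where the
   density is at least 1; no bound on the density from above is available or
   needed.  Let m(p) = E c_n(p).

   Bias.  By the intermediate value theorem on segments, the density, once cut
   off at a level below M, is M1-Lipschitz on the open square.  Hence, for small
   h and p at distance more than h from the boundary, (1 - m(p))_+ and
   (1 - c(p))_+ differ by at most 2 M1 h.  The remaining strip has area at most
   4 h, and there the trivial bound 1 is used.

   Variance.  Pointwise, E (c_n(p) - m(p))^2 is at most the mean of the squared
   kernel weights divided by n; this may be large, but its integral over p is
   not: integrating over p first, for a fixed sample, makes the density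
   disappear and leaves 4 b^4 / (n h^2), where b bounds K.  AM-GM
   |x| <= (t x^2 + 1 / t) / 2, with a single t balancing the two terms, plays
   the role of the Cauchy-Schwarz inequality. *)

Arguments leb2 {R}.
Arguments unit_sq {R}.

(** * Change of measure and change of variables *)

Section density.
Local Open Scope ereal_scope.
Context d (T : measurableType d) (R : realType).
Variables (mu nu : {measure set T -> \bar R}) (D : set T) (c : T -> R).
Hypotheses (mD : measurable D) (mc : measurable_fun setT c).
Hypothesis c0 : forall x, (0 <= c x)%R.
Hypothesis nuE : forall A, measurable A -> nu A = \int[mu]_(x in A `&` D) (c x)%:E.

Import HBNNSimple.

(** For simple functions this is linearity together with [nuE]; monotone convergence on both sides
    extends it to [f]. It turns expectations of functions of one observation into integrals against
    the copula density. *)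
Lemma ge0_integral_density (f : T -> R) : measurable_fun setT f ->
  (forall x, (0 <= f x)%R) ->
  \int[nu]_x (f x)%:E = \int[mu]_(x in D) (f x * c x)%:E.
Proof.
move=> mf f0; have mEf : measurable_fun setT (EFin \o f) by exact/measurable_EFinP.
pose g := nnsfun_approx measurableT mEf.
have g_cvg x : (g n x)%:E @[n --> \oo] --> (f x)%:E.
  by apply: cvg_nnsfun_approx => // y _; rewrite lee_fin.
have g_nd x : {homo (fun n => g n x) : m n / (m <= n)%N >-> (m <= n)%R}.
  by move=> m n mn; exact/lefP/nd_nnsfun_approx.
have mgc n : measurable_fun D (fun x => (g n x * c x)%:E).
  by apply/measurable_EFinP/measurable_funTS/measurable_funM.
transitivity (limn (fun n => \int[nu]_x (g n x)%:E)).
  rewrite -monotone_convergence//.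
  - by apply: eq_integral => x _; apply/esym/cvg_lim.
  - by move=> n; exact/measurable_EFinP.
  - by move=> n x _; rewrite lee_fin.
  - by move=> x _ m n mn; rewrite lee_fin g_nd.
transitivity (limn (fun n => \int[mu]_(x in D) (g n x * c x)%:E)); last first.
  rewrite -monotone_convergence//.
  - apply: eq_integral => x _; apply/cvg_lim => //.
    under eq_fun do rewrite EFinM.
    by rewrite EFinM; apply: cvgeZr.
  - by move=> n x _; rewrite lee_fin mulr_ge0.
  - by move=> x _ m n mn; rewrite lee_fin ler_wpM2r// g_nd.
congr (limn _); apply/funext => n.
(* Both sides become finite sums over the values [k] of [g n], compared term by term: the fibre over
   [k] has as its [nu]-measure the integral of [c] over its part in [D]. *)
rewrite integralT_nnsfun sintegralE.
under [RHS]eq_integral => x _.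
  rewrite (fimfunE (g n) x) EFinM -fsumEFin// ge0_mule_fsuml; last first.
    by move=> k; rewrite EFinM nnfun_muleindic_ge0.
  over.
have mgk k : measurable (g n @^-1` [set k]) by [].
rewrite ge0_integral_fsum//.
- apply: eq_fsbigr => k; rewrite inE => -[x _ gxk].
  have k0 : (0 <= k)%R by rewrite -gxk.
  under eq_integral do rewrite EFinM -muleA.
  rewrite ge0_integralZl_EFin//; last 2 first.
  - by move=> y _; rewrite -EFinM lee_fin mulr_ge0.
  - by apply/measurable_EFinP/measurable_funTS/measurable_funM.
  congr (_ * _); rewrite nuE// setIC integral_mkcondr; apply: eq_integral => y _.
  by rewrite epatch_indic /= muleC.
- move=> k; apply/measurable_EFinP; apply: measurable_funTS.
  by apply: measurable_funM => //; exact: measurable_funM.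
- move=> k x _; rewrite -EFinM lee_fin mulr_ge0//.
  by have := nnfun_muleindic_ge0 (g n) k x; rewrite -EFinM lee_fin.
Qed.

End density.

(** The image of Lebesgue measure under [phi], divided by [h], gives every half-open interval its
    length, so uniqueness identifies it with Lebesgue measure. *)
Lemma ge0_integral_affine (R : realType) (u h : R) (f : R -> R) :
  0 < h -> measurable_fun setT f -> (forall x, 0 <= f x) ->
  (\int[lebesgue_measure]_x (f ((u - x) / h))%:E =
   h%:E * \int[lebesgue_measure]_x (f x)%:E)%E.
Proof.
move=> h0 mf f0.
pose phi (x : measurableTypeR R) : measurableTypeR R := (u - x) / h.
have mphi : measurable_fun setT phi.
  by apply: measurable_funM => //; apply: measurable_funB.
pose mu : {measure set (measurableTypeR R) -> \bar R} := lebesgue_measure.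
have hi0 : 0 <= h^-1 by rewrite invr_ge0 ltW.
pose nu_ : {measure set (measurableTypeR R) -> \bar R} := mscale (NngNum hi0) (pushforward mu phi).
pose nu := nu_ mphi.
have nuE (A : set (measurableTypeR R)) : measurable A -> lebesgue_measure A = nu A.
  apply: lebesgue_measure_unique => _ [[a b]] _ <-.
  have -> : nu `]a, b]%classic = (h^-1%:E * lebesgue_measure (phi @^-1` `]a, b]))%E by [].
  (* [phi] is decreasing, so the preimage is closed on the left and open on the right. *)
  rewrite (_ : _ @^-1` _ = `[u - h * b, u - h * a[%classic); last first.
    apply/seteqP; split=> x; rewrite /= !in_itv /= /phi => /andP[].
      by rewrite ltr_pdivlMr// ler_pdivrMr// => ? ?; lra.
    by rewrite ltr_pdivlMr// ler_pdivrMr// => ? ?; lra.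
  rewrite !lebesgue_measure_itv /= !lte_fin ltrD2l ltrN2 ltr_pM2l//.
  case: ifPn => _; last by rewrite mule0.
  by rewrite -!EFinD -EFinM; congr EFin; field; rewrite gt_eqF.
rewrite [in RHS](eq_measure_integral nu); last by move=> A mA _; exact: nuE.
rewrite ge0_integral_mscale//; last 2 first.
- by apply/measurable_EFinP; exact: mf.
- by move=> x _; rewrite lee_fin.
rewrite ge0_integral_pushforward//; last 2 first.
- by apply/measurable_EFinP; exact: mf.
- by move=> x _; rewrite lee_fin.
by rewrite muleA -EFinM/= divff ?gt_eqF// mul1e preimage_setT.
Qed.

(** * Independence and the variance of a sum *)

Section independence.
Local Open Scope ereal_scope.
Context d d' (T : measurableType d) (S : measurableType d') (R : realType).
Variable P : probability T R.

(** The joint law agrees with the product of the two laws on rectangles, hence everywhere, and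
    Tonelli separates the variables. *)
Lemma ge0_integral_indep (X Y : T -> S) (f g : S -> R) :
  measurable_fun setT X -> measurable_fun setT Y ->
  (forall A B, measurable A -> measurable B ->
    P (X @^-1` A `&` Y @^-1` B) = P (X @^-1` A) * P (Y @^-1` B)) ->
  measurable_fun setT f -> measurable_fun setT g ->
  (forall x, (0 <= f x)%R) -> (forall x, (0 <= g x)%R) ->
  \int[P]_w (f (X w) * g (Y w))%:E =
  (\int[P]_w (f (X w))%:E) * \int[P]_w (g (Y w))%:E.
Proof.
move=> mX mY indep mf mg f0 g0.
pose X' : {RV P >-> S} := mfun_Sub (mem_set mX).
pose Y' : {RV P >-> S} := mfun_Sub (mem_set mY).
pose XY : {RV P >-> (S * S)%type} := mfun_Sub (mem_set (measurable_fun_pair mX mY)).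
have mfg : measurable_fun setT (fun z : S * S => (f z.1 * g z.2)%R).
  by apply: measurable_funM; exact: measurableT_comp.
have mEf : measurable_fun setT (EFin \o f) by exact/measurable_EFinP.
have mEg : measurable_fun setT (EFin \o g) by exact/measurable_EFinP.
transitivity (\int[distribution P XY]_z (f z.1 * g z.2)%:E).
  rewrite ge0_integral_distribution//; first exact/measurable_EFinP.
  by move=> z; rewrite lee_fin mulr_ge0.
rewrite -(eq_measure_integral (distribution P XY)
  (m1 := (distribution P X' \x distribution P Y'))); last first.
  move=> A mA _; apply: product_measure_unique; [|exact: mA] => B C mB mC.
  change (P (X @^-1` B `&` Y @^-1` C) = P (X @^-1` B) * P (Y @^-1` C)).
  exact: indep.
rewrite (fubini_tonelli1 (fun z => (f z.1 * g z.2)%:E))//=; last 2 first.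
- exact/measurable_EFinP.
- by move=> z; rewrite lee_fin mulr_ge0.
transitivity (\int[distribution P X']_x ((f x)%:E * \int[P]_w (g (Y w))%:E)).
  apply: eq_integral => x _; rewrite /fubini_F /=.
  under eq_integral do rewrite EFinM.
  rewrite ge0_integralZl_EFin//; last by move=> y _; rewrite lee_fin.
  by rewrite ge0_integral_distribution//= => y; rewrite lee_fin.
rewrite ge0_integralZr//.
- by rewrite ge0_integral_distribution//= => y; rewrite lee_fin.
- by move=> x _; rewrite lee_fin.
- by apply: integral_ge0 => w _; rewrite lee_fin.
Qed.

(** The variance of a sum of pairwise independent terms is the sum of the variances, each at most a
    second moment. Only nonnegative functions are integrated, so the second moments may be
    infinite. *)
Lemma integral_sum_centered_sqr_le n (X : 'I_n -> T -> S) (f : S -> R) (m : R) :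
  (0 < n)%N -> (forall i, measurable_fun setT (X i)) ->
  (forall i j, i != j -> forall A B, measurable A -> measurable B ->
    P (X i @^-1` A `&` X j @^-1` B) = P (X i @^-1` A) * P (X j @^-1` B)) ->
  measurable_fun setT f -> (forall x, (0 <= f x)%R) ->
  (forall i, \int[P]_w (f (X i w))%:E = m%:E) ->
  \int[P]_w ((\sum_(i < n) f (X i w) - n%:R * m) ^+ 2)%:E <=
  \sum_(i < n) \int[P]_w (f (X i w) ^+ 2)%:E.
Proof.
move=> n0 mX indep mf f0 EX.
have mfX i : measurable_fun setT (fun w => f (X i w)) by exact: measurableT_comp.
have m0 : (0 <= m)%R.
  by rewrite -lee_fin -(EX (Ordinal n0)); apply: integral_ge0 => w _; rewrite lee_fin.
have nm0 : (0 <= n%:R * m)%R by rewrite mulr_ge0.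
set I := \int[P]_w _.
pose s w : R := (\sum_(i < n) f (X i w))%R.
have ms : measurable_fun setT s by apply: measurable_sum.
have s0 w : (0 <= s w)%R by apply: sumr_ge0.
have Es : \int[P]_w (s w)%:E = (n%:R * m)%:E.
  rewrite /s; under eq_integral do rewrite -sumEFin.
  rewrite ge0_integral_sum//; last 2 first.
  - by move=> i; exact/measurable_EFinP.
  - by move=> i w _; rewrite lee_fin.
  under eq_bigr do rewrite EX.
  by rewrite sumEFin sumr_const card_ord mulr_natl.
have Es2 : \int[P]_w (s w ^+ 2)%:E <=
    \sum_(i < n) \int[P]_w (f (X i w) ^+ 2)%:E + ((n%:R * m) ^+ 2)%:E.
  have -> : \int[P]_w (s w ^+ 2)%:E =
      \sum_(i < n) \sum_(j < n) \int[P]_w (f (X i w) * f (X j w))%:E.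
    transitivity (\int[P]_w \sum_(i < n) \sum_(j < n) (f (X i w) * f (X j w))%:E).
      apply: eq_integral => w _; rewrite expr2 {1}/s mulr_suml -sumEFin.
      by apply: eq_bigr => i _; rewrite /s mulr_sumr -sumEFin.
    rewrite ge0_integral_sum//; last 2 first.
    - move=> i; apply: emeasurable_sum => j.
      by apply/measurable_EFinP; exact: measurable_funM.
    - by move=> i w _; apply: sume_ge0 => j _; rewrite lee_fin mulr_ge0.
    apply: eq_bigr => i _; rewrite ge0_integral_sum//.
    - by move=> j; apply/measurable_EFinP; exact: measurable_funM.
    - by move=> j w _; rewrite lee_fin mulr_ge0.
  have -> : ((n%:R * m) ^+ 2)%:E = \sum_(i < n) (n%:R * m ^+ 2)%:E.
    by rewrite sumEFin sumr_const card_ord -mulr_natl; congr EFin; ring.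
  (* In row [i] of the double sum the diagonal entry is kept; by independence the [n - 1] others
     equal [m ^ 2], and together they are at most [n m ^ 2]. *)
  rewrite -big_split /=; apply: lee_sum => i _.
  rewrite (bigD1 i)//=; apply: leeD.
    by under eq_integral do rewrite -expr2.
  have -> : \sum_(j < n | j != i) \int[P]_w (f (X i w) * f (X j w))%:E =
      \sum_(j < n | j != i) (m ^+ 2)%:E.
    apply: eq_bigr => j ji; rewrite ge0_integral_indep//.
      by rewrite !EX -EFinM expr2.
    by apply: indep; rewrite eq_sym.
  rewrite sumEFin lee_fin sumr_const -[leLHS]mulr_natl ler_wpM2r ?sqr_ge0//.
  by rewrite ler_nat (leq_trans (max_card _))// card_ord.
(* The cross term of the square is moved to the left, which avoids subtracting integrals: [(s - n m)
   ^ 2 + 2 n m s = s ^ 2 + (n m) ^ 2], and [s] has mean [n m]. *)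
have key : I + (2 * (n%:R * m) ^+ 2)%:E =
    \int[P]_w (s w ^+ 2)%:E + ((n%:R * m) ^+ 2)%:E.
  transitivity (\int[P]_w (((s w - n%:R * m) ^+ 2)%:E + (2 * (n%:R * m))%:E * (s w)%:E)).
    rewrite ge0_integralD//; last 4 first.
    - by move=> w _; rewrite lee_fin sqr_ge0.
    - by apply/measurable_EFinP; apply: measurable_funX; apply: measurable_funB.
    - by move=> w _; rewrite -EFinM lee_fin !mulr_ge0.
    - by apply: measurable_funeM; apply/measurable_EFinP.
    rewrite ge0_integralZl_EFin//; last 3 first.
    - by move=> w _; rewrite lee_fin.
    - exact/measurable_EFinP.
    - by rewrite mulr_ge0.
    by rewrite Es -EFinM -mulrA -expr2.
  transitivity (\int[P]_w ((s w ^+ 2)%:E + (cst ((n%:R * m) ^+ 2)%:E) w)).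
    by apply: eq_integral => w _; rewrite -EFinM -!EFinD; congr EFin => /=; ring.
  rewrite ge0_integralD//.
  - rewrite integral_cst//; congr (_ + _); rewrite -[RHS]mule1; congr (_ * _).
    exact: probability_setT.
  - by move=> w _; rewrite lee_fin sqr_ge0.
  - by apply/measurable_EFinP; exact: measurable_funX.
  - by move=> w _; rewrite lee_fin sqr_ge0.
rewrite -(@leeD2rE _ (2 * (n%:R * m) ^+ 2)%:E)// key.
rewrite (_ : 2 * _ = (n%:R * m) ^+ 2 + (n%:R * m) ^+ 2)%R; last by ring.
by rewrite EFinD addeA; apply: leeD2r.
Qed.

End independence.

(** * Integrals over the plane and the unit square *)

Section planar_integrals.
Variable R : realType.
Implicit Types (h b : R) (p q : R * R) (K f g : R -> R).

Lemma ge0_integral_leb2M f g :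
  measurable_fun setT f -> measurable_fun setT g ->
  (forall x, 0 <= f x) -> (forall x, 0 <= g x) ->
  (\int[leb2]_p (f p.1 * g p.2)%:E =
   (\int[lebesgue_measure]_x (f x)%:E) * \int[lebesgue_measure]_x (g x)%:E)%E.
Proof.
move=> mf mg f0 g0.
have mEf : measurable_fun setT (EFin \o f) by exact/measurable_EFinP.
have mEg : measurable_fun setT (EFin \o g) by exact/measurable_EFinP.
have mfg : measurable_fun setT (fun z : R * R => f z.1 * g z.2).
  by apply: measurable_funM; exact: measurableT_comp.
pose F p : \bar R := (f p.1 * g p.2)%:E.
have mF : measurable_fun setT F by exact/measurable_EFinP.
have F0 p : (0 <= F p)%E by rewrite lee_fin mulr_ge0.
apply: etrans (fubini_tonelli1 (m1 := lebesgue_measure) (m2 := lebesgue_measure) F mF F0) _.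
transitivity (\int[lebesgue_measure]_x
    ((f x)%:E * \int[lebesgue_measure]_y (g y)%:E))%E.
  apply: eq_integral => x _; rewrite /fubini_F /F /=.
  under eq_integral do rewrite EFinM.
  by rewrite ge0_integralZl_EFin// => y _; rewrite lee_fin.
rewrite ge0_integralZr//; first by move=> x _; rewrite lee_fin.
by apply: integral_ge0 => x _; rewrite lee_fin.
Qed.

Lemma measurable_unit_sq : measurable (@unit_sq R).
Proof. by apply: measurableX; exact: measurable_itv. Qed.

Lemma leb2_unit_sq : leb2 (@unit_sq R) = 1%E.
Proof.
rewrite /leb2 product_measure1E//; [|exact: measurable_itv..].
by rewrite /= !lebesgue_measure_itv/= !lte_fin ltr01 oppr0 adde0 mule1.
Qed.

Lemma unit_sq_indic p : \1_unit_sq p = \1_`[0, 1] p.1 * \1_`[0, 1] p.2 :> R.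
Proof. by rewrite !indicE -natrM mulnb /unit_sq in_setX. Qed.

Lemma integral_itv_indic (a r : R) : 0 <= r ->
  (\int[lebesgue_measure]_x (\1_`[a, (a + r)] x)%:E = r%:E)%E.
Proof.
move=> r0; rewrite integral_indic ?setIT//.
rewrite [LHS]lebesgue_measure_itv/= lte_fin ltrDl -EFinB addrAC subrr add0r.
by case: ltgtP r0 => // <-.
Qed.

(** On the unit square this dominates the indicator of the strip of width [h] along the boundary.
    Corners are counted twice, so that every summand depends on one coordinate only. *)
Definition border h p : R :=
  \1_`[0, h] p.1 + \1_`[1 - h, 1] p.1 + (\1_`[0, h] p.2 + \1_`[1 - h, 1] p.2).

Lemma border_ge0 h p : 0 <= border h p.
Proof. by rewrite /border !addr_ge0. Qed.

Lemma measurable_border h : measurable_fun setT (border h).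
Proof.
by apply: measurable_funD; apply: measurable_funD;
  apply: measurableT_comp => //; apply: measurable_indic; exact: measurable_itv.
Qed.

Lemma border_ge1 h p : unit_sq p ->
  ~ (h < p.1 < 1 - h /\ h < p.2 < 1 - h) -> 1 <= border h p.
Proof.
have aux (x : R) : x \in `[0, 1] -> ~ (h < x < 1 - h) ->
    1 <= (\1_`[0, h] x + \1_`[1 - h, 1] x : R).
  rewrite in_itv/= => /andP[x0 x1] hx; rewrite !indicE !mem_setE !in_itv/= x0 x1 andbT/=.
  have [_|xh] := leP x h; first by rewrite lerDl.
  have [_|xh1] := leP (1 - h) x; first by rewrite add0r.
  by case: hx; rewrite xh xh1.
move=> [/= p1 p2] /not_andP[] hp; rewrite /border.
  by rewrite (le_trans (aux _ p1 hp))// lerDl addr_ge0.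
by rewrite (le_trans (aux _ p2 hp))// lerDr addr_ge0.
Qed.

(** Each of the four summands lives on a product of intervals of lengths [h] and 1. For large [h]
    these leave the square, hence an inequality. *)
Lemma integral_border h : 0 <= h ->
  (\int[leb2]_(p in unit_sq) (border h p)%:E <= (4 * h)%:E)%E.
Proof.
move=> h0.
have mI (a r : R) : measurable_fun setT (\1_`[a, r] : R -> R).
  by apply: measurable_indic; exact: measurable_itv.
have I1 (a : R) : (\int[leb2]_(p in unit_sq) (\1_`[a, (a + h)] p.1)%:E <= h%:E)%E.
  rewrite integral_mkcond epatch_indic.
  apply: (@le_trans _ _ (\int[leb2]_p (\1_`[a, (a + h)] p.1 * \1_`[0, (0 + 1)] p.2)%:E)%E).
    apply: ge0_le_integral => //.
    - by move=> p _ /=; rewrite -EFinM lee_fin mulr_ge0.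
    - apply/measurable_EFinP; apply: measurable_funM.
        by apply: measurableT_comp.
      exact: measurable_indic measurable_unit_sq.
    - apply/measurable_EFinP; apply: measurable_funM; exact: measurableT_comp.
    move=> p _ /=; rewrite -EFinM lee_fin unit_sq_indic add0r ler_wpM2l//.
    by rewrite ler_piMl// indicE lern1 leq_b1.
  by rewrite ge0_integral_leb2M// !integral_itv_indic// mule1.
have I2 (a : R) : (\int[leb2]_(p in unit_sq) (\1_`[a, (a + h)] p.2)%:E <= h%:E)%E.
  rewrite integral_mkcond epatch_indic.
  apply: (@le_trans _ _ (\int[leb2]_p (\1_`[0, (0 + 1)] p.1 * \1_`[a, (a + h)] p.2)%:E)%E).
    apply: ge0_le_integral => //.
    - by move=> p _ /=; rewrite -EFinM lee_fin mulr_ge0.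
    - apply/measurable_EFinP; apply: measurable_funM.
        by apply: measurableT_comp.
      exact: measurable_indic measurable_unit_sq.
    - apply/measurable_EFinP; apply: measurable_funM; exact: measurableT_comp.
    move=> p _ /=; rewrite -EFinM lee_fin unit_sq_indic add0r mulrC ler_wpM2r//.
    by rewrite ler_piMr// indicE lern1 leq_b1.
  by rewrite ge0_integral_leb2M// !integral_itv_indic// mul1e.
have mU := measurable_unit_sq.
have m1 (a r : R) : measurable_fun unit_sq (fun p : R * R => (\1_`[a, r] p.1 : R)%:E).
  by apply/measurable_EFinP; apply: measurable_funTS; apply: measurableT_comp.
have m2 (a r : R) : measurable_fun unit_sq (fun p : R * R => (\1_`[a, r] p.2 : R)%:E).
  by apply/measurable_EFinP; apply: measurable_funTS; apply: measurableT_comp.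
rewrite (_ : (4 * h)%:E = h%:E + h%:E + (h%:E + h%:E))%E; last first.
  by rewrite -!EFinD; congr EFin; ring.
rewrite /border; under eq_integral do rewrite !EFinD.
have i0 (A : set R) (x : R) : (0 <= (\1_A x : R)%:E)%E by rewrite lee_fin.
rewrite ge0_integralD//; last 4 first.
- by move=> p _; apply: adde_ge0.
- by apply: emeasurable_funD; exact: m1.
- by move=> p _; apply: adde_ge0.
- by apply: emeasurable_funD; exact: m2.
rewrite ge0_integralD//; [|exact: m1|exact: m1].
rewrite ge0_integralD//; [|exact: m2|exact: m2].
have Ih := I1 0; have Jh := I1 (1 - h).
have Ih2 := I2 0; have Jh2 := I2 (1 - h).
rewrite add0r in Ih Ih2; rewrite subrK in Jh Jh2.
by apply: leeD; apply: leeD.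
Qed.

(** The factor [1 / h ^ 2] is left out, so the total mass is [h ^ 2] rather than 1. *)
Definition kernel2 K h p q : R := K ((p.1 - q.1) / h) * K ((p.2 - q.2) / h).

Lemma measurable_kernel2l K h p : measurable_fun setT K ->
  measurable_fun setT (kernel2 K h p).
Proof.
move=> mK; apply: measurable_funM; apply: measurableT_comp => //;
  by apply: measurable_funM => //; apply: measurable_funB.
Qed.

Lemma integral_kernel2 K h p : 0 < h -> kernel_ok K ->
  (\int[leb2]_q (kernel2 K h p q)%:E = (h ^+ 2)%:E)%E.
Proof.
move=> h0 [mK [K0 [_ [_ [K1 _]]]]].
have mKh (u : R) : measurable_fun setT (fun x : R => K ((u - x) / h)).
  by apply: measurableT_comp => //; apply: measurable_funM => //; apply: measurable_funB.
rewrite (ge0_integral_leb2M (fun x => K ((p.1 - x) / h)) (fun x => K ((p.2 - x) / h)))//.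
by rewrite !ge0_integral_affine// K1 !mule1 -EFinM expr2.
Qed.

(** In each coordinate the squared kernel is at most [b ^ 2] on an interval of length [2 h] and zero
    elsewhere. The integration runs over the point [p] of evaluation with the observation [q] fixed,
    so no density enters. *)
Lemma integral_kernel2_sqr_le K h b q : 0 < h -> kernel_ok K ->
  (forall x, K x <= b) ->
  (\int[leb2]_p (kernel2 K h p q ^+ 2)%:E <= ((2 * b ^+ 2 * h) ^+ 2)%:E)%E.
Proof.
move=> h0 [mK [K0 [_ [Ks _]]]] Kb.
have b0 : 0 <= b by rewrite (le_trans (K0 0)).
pose J (a x : R) : R := b ^+ 2 * \1_`[(a - h), (a - h + (h + h))] x.
have mJ a : measurable_fun setT (J a).
  by apply: measurable_funM => //; apply: measurable_indic; exact: measurable_itv.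
have J0 a x : 0 <= J a x by rewrite mulr_ge0// sqr_ge0.
have KJ a x : K ((x - a) / h) ^+ 2 <= J a x.
  rewrite /J indicE mem_setE in_itv/=.
  have [xa|/negP xa] := boolP (`|(x - a) / h| <= 1); last first.
    by rewrite Ks ?expr0n ?mulr_ge0 ?sqr_ge0// ltNge; apply/negP.
  rewrite (_ : _ && _ = true) ?mulr1; first by rewrite lerXn2r ?nnegrE.
  move: xa; rewrite ler_norml ler_pdivlMr// ler_pdivrMr// => /andP[? ?].
  by apply/andP; split; lra.
have IJ a : (\int[lebesgue_measure]_x (J a x)%:E = (2 * b ^+ 2 * h)%:E)%E.
  rewrite /J; under eq_integral do rewrite EFinM.
  rewrite ge0_integralZl_EFin//; last 2 first.
  - by apply/measurable_EFinP; apply: measurable_indic; exact: measurable_itv.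
  - by rewrite sqr_ge0.
  rewrite integral_itv_indic ?addr_ge0 ?ltW// -EFinM; congr EFin; ring.
apply: (@le_trans _ _ (\int[leb2]_p (J q.1 p.1 * J q.2 p.2)%:E)%E).
  apply: ge0_le_integral => //.
  - by move=> p _; rewrite lee_fin sqr_ge0.
  - apply/measurable_EFinP; apply: measurable_funX; apply: measurable_funM;
      apply: measurableT_comp => //; apply: measurable_funM => //;
      by apply: measurable_funB.
  - apply/measurable_EFinP; apply: measurable_funM.
      exact: (measurableT_comp (mJ q.1)).
    exact: (measurableT_comp (mJ q.2)).
  - by move=> p _; rewrite lee_fin exprMn ler_pM ?sqr_ge0.
by rewrite ge0_integral_leb2M// !IJ -EFinM -expr2.
Qed.

(** Pointwise [|c - 1| = 2 (1 - c)_+ + c - 1], and [c] has total mass 1 on the square. *)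
Lemma Ccor_integral_max (c : R * R -> R) : copula_density c ->
  Ccor c = (\int[leb2]_(p in unit_sq) (Num.max (1 - c p) 0)%:E)%E.
Proof.
move=> [mc [c0 [cl _]]].
have mU := measurable_unit_sq.
have mcU : measurable_fun unit_sq c by exact: measurable_funTS.
have mx : measurable_fun unit_sq (fun p => Num.max (1 - c p) 0).
  by apply: measurable_maxr => //; exact: measurable_funB.
have mn : measurable_fun unit_sq (fun p => `|c p - 1|).
  by apply: measurableT_comp => //; exact: measurable_funB.
have Ic : (\int[leb2]_(p in unit_sq) (c p)%:E = 1)%E.
  by have := cl 1; rewrite ler01 lexx; apply.
set I := (\int[leb2]_(p in unit_sq) (Num.max _ _)%:E)%E.
rewrite /Ccor; set J := (\int[leb2]_(p in unit_sq) _)%E.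
(* Adding 1 to both sides makes all integrands nonnegative. *)
have : (J + 1 = 2%:E * I + 1)%E.
  transitivity (\int[leb2]_(p in unit_sq) ((`|c p - 1|)%:E + cst 1%:E p))%E.
    rewrite ge0_integralD//; last exact/measurable_EFinP.
    congr (_ + _)%E; rewrite integral_cst// -[LHS]mul1e; congr (_ * _)%E.
    by apply/esym; exact: leb2_unit_sq.
  transitivity (\int[leb2]_(p in unit_sq) (2%:E * (Num.max (1 - c p) 0)%:E + (c p)%:E))%E.
    apply: eq_integral => p _; rewrite -EFinM -!EFinD; congr EFin => /=.
    have [c1|c1] := leP (1 - c p) 0.
      by rewrite ger0_norm; lra.
    by rewrite ler0_norm; lra.
  rewrite ge0_integralD//; last 4 first.
  - by move=> p _; rewrite -EFinM lee_fin mulr_ge0// le_max lexx orbT.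
  - by apply: measurable_funeM; exact/measurable_EFinP.
  - by move=> p _; rewrite lee_fin.
  - exact/measurable_EFinP.
  rewrite Ic ge0_integralZl_EFin//; last exact/measurable_EFinP.
  by move=> p _; rewrite lee_fin le_max lexx orbT.
move=> /(congr1 (fun x => x - 1)%E); rewrite !addeK// => ->.
by rewrite muleA -EFinM mul1r mulVf ?pnatr_eq0// mul1e.
Qed.

End planar_integrals.

(** * The truncated density and the bias *)

Section truncated_density.
Variables (R : realType) (M M1 : R) (c : R * R -> R).
Hypotheses (M1_gt0 : 0 < M1) (cC : copula_class M M1 c).
Implicit Types p q : R * R.

Lemma open_open_unit_sq : open (@open_unit_sq R).
Proof.
apply: openI; apply: open_comp; first by move=> p _; exact: cvg_fst.
- exact: itv_open.
- by move=> p _; exact: cvg_snd.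
- exact: itv_open.
Qed.

(* The Lipschitz bound only holds below the level [M]; the intermediate value
   theorem on the segment from [p] to [q] produces a point where the density
   equals the level [m], which is still below [M]. *)
Lemma copula_class_crossing p q (m : R) :
  open_unit_sq p -> open_unit_sq q -> c p < m -> m < M -> m <= c q ->
  m - c p <= M1 * dist2 p q.
Proof.
move: cC => [_ [cc cL]] op oq cpm mM cqm.
pose seg (t : R) : R * R := (p.1 + t * (q.1 - p.1), p.2 + t * (q.2 - p.2)).
have oseg t : t \in `[0, 1] -> open_unit_sq (seg t).
  have aux (x y : R) : x \in `]0, 1[ -> y \in `]0, 1[ -> t \in `[0, 1] ->
      x + t * (y - x) \in `]0, 1[.
    rewrite !in_itv/= => /andP[x0 x1] /andP[y0 y1] /andP[t0 t1].
    have t10 : 0 <= 1 - t by rewrite subr_ge0.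
    have [|/ltW] := leP x y; rewrite -subr_ge0 => xy;
      have := mulr_ge0 t0 xy; have := mulr_ge0 t10 xy => ? ?;
      by apply/andP; split; nra.
  by move=> t01; case: op oq => [/= p1 p2] [/= q1 q2]; split; exact: aux.
have cseg : {within `[0, 1], continuous (c \o seg)}.
  apply: within_continuous_comp.
    move=> _ /set_mem[t t01 <-].
    move: cc; rewrite (continuous_open_subspace _ open_open_unit_sq); apply.
    by rewrite inE; exact: oseg.
  apply: continuous_subspaceT => t.
  have caff (x d : R) : x + s * d @[s --> t] --> x + t * d.
    by apply: cvgD; [exact: cvg_cst|apply: cvgM; [exact: cvg_id|exact: cvg_cst]].
  exact: (cvg_pair (caff p.1 (q.1 - p.1)) (caff p.2 (q.2 - p.2))).
have [t t01 ct] : exists2 t, t \in `[0, 1] & (c \o seg) t = m.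
  apply: IVT => //=; have -> : seg 0 = p by rewrite /seg !mul0r !addr0 -surjective_pairing.
  have -> : seg 1 = q by rewrite /seg !mul1r !subrKC -surjective_pairing.
  by rewrite ge_min le_max cqm (ltW cpm) orbT.
have := cL p (seg t) op (oseg t t01); have {}ct : c (seg t) = m by [].
rewrite ct (lt_trans cpm)// => /(_ isT); rewrite mM => /(_ isT).
rewrite distrC ger0_norm; last by rewrite subr_ge0 ltW.
move=> /le_trans; apply.
(* The crossing point [seg t] is no farther from [p] than [q] is, because [t <= 1]. *)
rewrite ler_pM2l// /dist2 ler_wsqrtr//=.
move: t01; rewrite in_itv/= => /andP[t0 t1].
have t21 : t ^+ 2 <= 1 by rewrite expr_le1.
have sqt (x y : R) : (x - (x + t * (y - x))) ^+ 2 <= (x - y) ^+ 2.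
  rewrite (_ : x - _ = t * (x - y)); last by ring.
  by rewrite exprMn ler_piMl// sqr_ge0.
by apply: lerD.
Qed.

Hypothesis M_gt1 : 1 < M.
Variables (K : R -> R) (h : R) (p : R * R).
Hypotheses (h_gt0 : 0 < h) (hM : 2 * M1 * h < M - 1) (K_ok : kernel_ok K).
Hypotheses (p1 : h < p.1 < 1 - h) (p2 : h < p.2 < 1 - h).

Lemma kernel2_support q : kernel2 R K h p q != 0 ->
  `|p.1 - q.1| <= h /\ `|p.2 - q.2| <= h.
Proof.
have [_ [_ [_ [Ks _]]]] := K_ok.
rewrite /kernel2 mulf_eq0 negb_or => /andP[k1 k2].
have aux (x : R) : K (x / h) != 0 -> `|x| <= h.
  move=> /eqP Kx; rewrite leNgt; apply/negP => hx; apply: Kx; apply: Ks.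
  by rewrite normrM normfV (gtr0_norm h_gt0) ltr_pdivlMr// mul1r.
by split; apply: aux.
Qed.

(** Since [p] is more than [h] away from the boundary, the square of half-side [h] around it stays
    inside. Its points are within [sqrt 2 h] of [p], rounded up to [2 h]. *)
Lemma kernel2_support_open q : kernel2 R K h p q != 0 ->
  open_unit_sq q /\ M1 * dist2 p q <= 2 * M1 * h.
Proof.
move=> /kernel2_support[q1 q2]; move: (q1) (q2); rewrite !ler_norml => /andP[a1 b1] /andP[a2 b2].
move/andP: p1 => [c1 d1]; move/andP: p2 => [c2 d2].
split; first by split; rewrite /= in_itv/=; apply/andP; split; lra.
rewrite [2 * M1]mulrC -mulrA ler_pM2l// /dist2.
rewrite -[leRHS]ger0_norm; last by rewrite mulr_ge0// ltW.
rewrite -sqrtr_sqr ler_wsqrtr//.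
have sqh (x : R) : - h <= x -> x <= h -> x ^+ 2 <= h ^+ 2.
  by move=> xl xr; rewrite -subr_ge0 subr_sqr mulr_ge0//; lra.
have := sqh _ a1 b1; have := sqh _ a2 b2; have := sqr_ge0 h.
rewrite (_ : (2 * h) ^+ 2 = 4 * h ^+ 2); last by ring.
by move=> *; lra.
Qed.

Lemma open_unit_sq_interior : open_unit_sq p.
Proof.
move/andP: p1 => [c1 d1]; move/andP: p2 => [c2 d2]; have h0 := h_gt0.
by split; rewrite /= in_itv/=; apply/andP; split; lra.
Qed.

(** Only [c q < 1] is of interest. Then the Lipschitz bound applies directly if also [c p < 1];
    otherwise the density climbs from [q] to the level 1 on the way to [p]. Cutting at 1 is harmless
    because [(1 - x)_+ = 1 - min(x, 1)]. *)
Lemma density_lower_bound q : open_unit_sq q -> M1 * dist2 p q <= 2 * M1 * h ->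
  Num.min (c p) 1 <= c q + 2 * M1 * h.
Proof.
have op := open_unit_sq_interior.
move=> oq dpq; rewrite ge_min; have [cq1|cq1] := ltP (c q) 1; last first.
  by apply/orP; right; rewrite (le_trans cq1)// lerDl !mulr_ge0 ?ltW.
have dqp : dist2 q p = dist2 p q.
  by rewrite /dist2 -sqrrN opprB -[X in _ + X]sqrrN opprB.
have [cp1|cp1] := ltP (c p) 1.
  have [_ [_ cL]] := cC.
  have /(le_trans (ler_norm _)) := cL p q op oq (lt_trans cp1 M_gt1) (lt_trans cq1 M_gt1).
  by move=> ?; apply/orP; left; lra.
have := copula_class_crossing q p 1 oq op cq1 M_gt1 cp1.
by rewrite dqp => ?; apply/orP; right; lra.
Qed.

(** A density below 1 at [p] cannot reach [M] within the support of the kernel, so the Lipschitz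
    bound applies at [q] as well. *)
Lemma density_upper_bound q : open_unit_sq q -> M1 * dist2 p q <= 2 * M1 * h ->
  c p < 1 -> c q <= c p + 2 * M1 * h.
Proof.
have op := open_unit_sq_interior.
move=> oq dpq cp1; have [cqM|cqM] := ltP (c q) M.
  have [_ [_ cL]] := cC.
  have := cL p q op oq (lt_trans cp1 M_gt1) cqM.
  by rewrite distrC => /(le_trans (ler_norm _)) ?; lra.
(* If [c q >= M], a level [m] strictly between [1 + 2 M1 h] and [M], which exists by [hM], is
   crossed on the segment. Then [m - c p <= 2 M1 h] contradicts [c p < 1]. *)
have eM := hM; pose m := (1 + 2 * M1 * h + M) / 2.
have e0 : 0 < 2 * M1 * h by rewrite !mulr_gt0.
have mM : m < M by rewrite /m; lra.
have m1 : 1 + 2 * M1 * h < m by rewrite /m; lra.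
have := copula_class_crossing p q m op oq.
have -> : c p < m by lra.
rewrite mM (le_trans (ltW mM) cqM) => /(_ isT isT isT) ?.
by lra.
Qed.

(** Here [m] is the kernel-weighted mean of the density around [p], so the two pointwise bounds are
    averaged against the kernel. An upper bound on [m] is available only if [c p < 1]; if
    [c p >= 1], then [(1 - c p)_+ = 0] and the lower bound on [m] suffices. *)
Lemma bias_bound (m : R) :
  (\int[leb2]_(q in unit_sq) (kernel2 R K h p q * c q)%:E = (h ^+ 2 * m)%:E)%E ->
  `|Num.max (1 - m) 0 - Num.max (1 - c p) 0| <= 2 * M1 * h.
Proof.
move=> Em; have [[mc [c0 _]] _] := cC; have [mK [K0 _]] := K_ok.
set e := 2 * M1 * h.
have e0 : 0 <= e by rewrite !mulr_ge0 ?ltW.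
have mU := measurable_unit_sq R.
have mk := measurable_kernel2l R K h p mK.
have k0 q : 0 <= kernel2 R K h p q by rewrite mulr_ge0.
have h20 : 0 < h ^+ 2 by rewrite exprn_gt0.
have subU q : open_unit_sq q -> unit_sq q.
  by move=> [/= q1 q2]; split; apply: subset_itv_oo_cc.
(* No kernel mass is lost outside the square, as [p] is far enough from the boundary. *)
have IkE : (\int[leb2]_(q in unit_sq) (kernel2 R K h p q)%:E = (h ^+ 2)%:E)%E.
  rewrite -(integral_kernel2 R K h p)// integral_mkcond.
  apply: eq_integral => q _; rewrite patchE; case: ifPn => //.
  rewrite notin_setE => nq; congr EFin; apply/eqP; rewrite eq_sym.
  apply/negPn/negP => /kernel2_support_open[/subU] //.
have Ik a : 0 <= a ->
    (\int[leb2]_(q in unit_sq) (kernel2 R K h p q * a)%:E = (h ^+ 2 * a)%:E)%E.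
  move=> a0; under eq_integral do rewrite EFinM.
  rewrite ge0_integralZr//; last 2 first.
  - by apply/measurable_EFinP; exact: measurable_funTS.
  - by move=> q _; rewrite lee_fin.
  by rewrite IkE.
have mkc : measurable_fun unit_sq (fun q => kernel2 R K h p q * c q).
  by apply: measurable_funTS; exact: measurable_funM.
have mka a : measurable_fun unit_sq (fun q => kernel2 R K h p q * a).
  by apply: measurable_funTS; apply: measurable_funM.
have lower : Num.min (c p) 1 <= m + e.
  have min0 : 0 <= Num.min (c p) 1 by rewrite le_min c0 ler01.
  rewrite -(ler_pM2l h20) -lee_fin mulrDr EFinD -Em -(Ik e)// -(Ik (Num.min _ _))//.
  rewrite -ge0_integralD//; last 4 first.
  - by move=> q _; rewrite lee_fin mulr_ge0.
  - exact/measurable_EFinP.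
  - by move=> q _; rewrite lee_fin mulr_ge0.
  - by apply/measurable_EFinP; exact: mka.
  apply: ge0_le_integral => //.
  - by move=> q _; rewrite lee_fin mulr_ge0// le_min c0 ler01.
  - by apply/measurable_EFinP; exact: mka.
  - by apply/measurable_EFinP; apply: measurable_funD => //; exact: mka.
  move=> q _; rewrite -EFinD lee_fin -mulrDr.
  have [->|/kernel2_support_open[oq dpq]] := eqVneq (kernel2 R K h p q) 0.
    by rewrite !mul0r.
  by rewrite ler_wpM2l// density_lower_bound.
have upper : c p < 1 -> m <= c p + e.
  move=> cp1; rewrite -(ler_pM2l h20) -lee_fin -Em -Ik ?addr_ge0//.
  apply: ge0_le_integral => //.
  - by move=> q _; rewrite lee_fin mulr_ge0.
  - exact/measurable_EFinP.
  - by apply/measurable_EFinP; exact: mka.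
  move=> q _; rewrite lee_fin.
  have [->|/kernel2_support_open[oq dpq]] := eqVneq (kernel2 R K h p q) 0.
    by rewrite !mul0r.
  by rewrite ler_wpM2l// density_upper_bound.
move: lower; rewrite ge_min ler_norml; have [cp1|cp1] := ltP (c p) 1.
  move: (upper cp1) => um /orP[] lm;
    by case: (leP (1 - m) 0) => ?; case: (leP (1 - c p) 0) => ?; apply/andP; split; lra.
move=> /orP[] lm;
  by case: (leP (1 - m) 0) => ?; case: (leP (1 - c p) 0) => ?; apply/andP; split; lra.
Qed.

End truncated_density.

(** * Tonelli's theorem for the sample space and the unit square *)

Lemma sigma_finite_leb2 (R : realType) : sigma_finite setT (@leb2 R).
Proof.
have /sigma_finiteP[F [TF ndF Foo]] := sigma_finiteT (@lebesgue_measure R).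
exists (fun k => F k `*` F k).
  apply/seteqP; split=> // -[x y] _; have : setT x /\ setT y by [].
  rewrite TF => -[[k _ Fx] [l _ Fy]]; exists (maxn k l) => //; split => /=.
  - by move: x Fx; exact/subsetPset/ndF/leq_maxl.
  - by move: y Fy; exact/subsetPset/ndF/leq_maxr.
move=> k; have [mF Fk] := Foo k; split; first exact: measurableX.
by rewrite /leb2 product_measure1E// lte_mul_pinfty// ge0_fin_numE.
Qed.

(** The measure of [leb2] bundled with its sigma-finiteness, as Tonelli's theorem requires. *)
Definition leb2_sigma_finite_measure (R : realType) : {sigma_finite_measure
    set (measurableTypeR R * measurableTypeR R)%type -> \bar R} :=
  HB.pack (@lebesgue_measure R \x @lebesgue_measure R)%E
    (Measure_isSigmaFinite.Build _ _ _ (@lebesgue_measure R \x @lebesgue_measure R)%E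
      (sigma_finite_leb2 R)).

Section integrals_over_unit_sq.
Variables (R : realType) (d : measure_display) (T : measurableType d).
Variable f : T * (R * R) -> R.
Hypotheses (mf : measurable_fun setT f) (f0 : forall z, 0 <= f z).

(** The restriction to the square is moved into the integrand, so that Tonelli applies on the whole
    product space. *)
Let g (z : T * (measurableTypeR R * measurableTypeR R)) : \bar R :=
  (f z * \1_unit_sq z.2)%:E.

Let mg : measurable_fun setT g.
Proof.
apply/measurable_EFinP; apply: measurable_funM => //.
have mU : measurable_fun setT
    (\1_unit_sq : measurableTypeR R * measurableTypeR R -> R).
  by apply: measurable_indic; exact: measurable_unit_sq.
exact: (measurableT_comp mU measurable_snd).
Qed.

Let g0 z : (0 <= g z)%E.
Proof. by rewrite lee_fin mulr_ge0. Qed.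

Let integral_g w : (\int[leb2]_(p in unit_sq) (f (w, p))%:E =
  \int[leb2_sigma_finite_measure R]_p g (w, p))%E.
Proof.
rewrite integral_mkcond epatch_indic.
by apply: eq_integral => p _; rewrite /= -EFinM.
Qed.

Lemma measurable_integral_unit_sq :
  measurable_fun setT (fun w => \int[leb2]_(p in unit_sq) (f (w, p))%:E)%E.
Proof.
under eq_fun do rewrite integral_g.
exact: (measurable_fun_fubini_tonelli_F (m2 := leb2_sigma_finite_measure R) g mg g0).
Qed.

Lemma tonelli_unit_sq (P : probability T R) :
  (\int[P]_w \int[leb2]_(p in unit_sq) (f (w, p))%:E =
   \int[leb2]_(p in unit_sq) \int[P]_w (f (w, p))%:E)%E.
Proof.
under eq_integral do rewrite integral_g.
rewrite (fubini_tonelli (m1 := P) (m2 := leb2_sigma_finite_measure R) g mg g0).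
rewrite [RHS]integral_mkcond epatch_indic.
apply: eq_integral => p _; rewrite /g /=; under eq_integral do rewrite EFinM.
rewrite ge0_integralZr//; last by move=> w _; rewrite lee_fin.
by apply/measurable_EFinP; exact: (measurableT_comp mf (pair2_measurable p)).
Qed.

End integrals_over_unit_sq.

(** * The risk for a fixed copula and sample *)

Section risk.
Variables (R : realType) (M M1 : R) (K : R -> R) (c : R * R -> R).
Hypotheses (M_gt1 : 1 < M) (M1_gt0 : 0 < M1) (K_ok : kernel_ok K).
Hypothesis cC : copula_class M M1 c.
Variables (d : measure_display) (T : measurableType d) (P : probability T R).
Variables (n : nat) (X : 'I_n -> T -> R * R).
Hypotheses (n_gt0 : (0 < n)%N) (X_iid : iid_copula_sample P X c).
Implicit Types (h t b : R) (p q : R * R) (w : T).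

Let mX i : measurable_fun setT (X i). Proof. by have [] := X_iid. Qed.
Let mK : measurable_fun setT K. Proof. by have [] := K_ok. Qed.
Let K_ge0 x : 0 <= K x. Proof. by have [_ []] := K_ok. Qed.
Let mc : measurable_fun setT c. Proof. by have [[]] := cC. Qed.
Let c_ge0 p : 0 <= c p. Proof. by have [[_ []]] := cC. Qed.

Lemma kernel2_ge0 h p q : 0 <= kernel2 R K h p q.
Proof. by rewrite mulr_ge0. Qed.

(** The law of an observation has density [c] on the square. The right-hand side is free of [i]: all
    observations share one mean. *)
Lemma integral_kernel2_sample h p i :
  (\int[P]_w (kernel2 R K h p (X i w))%:E =
   \int[leb2]_(q in unit_sq) (kernel2 R K h p q * c q)%:E)%E.
Proof.
have [_ [Xlaw _]] := X_iid.
(* [leb2] lives on [measurableTypeR R * measurableTypeR R], whose measurable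
   sets are those of [R * R] but with another display *)
pose Xi : T -> measurableTypeR R * measurableTypeR R := X i.
pose k : measurableTypeR R * measurableTypeR R -> R := kernel2 R K h p.
have mXi : measurable_fun setT Xi by exact: mX.
pose X' : {RV P >-> (measurableTypeR R * measurableTypeR R)%type} := mfun_Sub (mem_set mXi).
have mk : measurable_fun setT (EFin \o k).
  by apply/measurable_EFinP; exact: measurable_kernel2l.
rewrite -(ge0_integral_distribution X' mk); last first.
  by move=> q; rewrite lee_fin kernel2_ge0.
have Xd A : measurable A ->
    distribution P X' A = (\int[leb2]_(q in A `&` unit_sq) (c q)%:E)%E.
  by move=> mA; exact: Xlaw.
exact: (ge0_integral_density _ _ _ leb2 (distribution P X') unit_sq c
  (measurable_unit_sq R) mc c_ge0 Xd k (measurable_kernel2l R K h p mK) (kernel2_ge0 h p)).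
Qed.

(** The product formula is applied to the family equal to [A] at [i], to [B] at [j] and to the whole
    plane elsewhere, where the factors are 1. *)
Lemma sample_pairwise_indep i j : i != j -> forall A B : set (R * R),
  measurable A -> measurable B ->
  (P (X i @^-1` A `&` X j @^-1` B) = P (X i @^-1` A) * P (X j @^-1` B))%E.
Proof.
move=> ij A B mA mB; have [_ [_ XI]] := X_iid.
pose C k : set (R * R) := if k == i then A else if k == j then B else setT.
have mC k : measurable (C k) by rewrite /C; case: ifP => // _; case: ifP.
have PT : fine (P setT) = 1 by rewrite probability_setT.
have mP k (D : set (R * R)) : measurable D -> P (X k @^-1` D) \is a fin_num.
  by move=> mD; apply: fin_num_measure; rewrite -[X in measurable X]setTI; exact: mX.
have := XI C mC; rewrite (_ : \bigcap_k _ = X i @^-1` A `&` X j @^-1` B); last first.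
  apply/seteqP; split=> [w Cw|w [wA wB] k _].
    split; first by have := Cw i I; rewrite /C eqxx.
    by have := Cw j I; rewrite /C eqxx eq_sym (negPf ij).
  by rewrite /C; case: eqP => [->//|_]; case: eqP => [->|].
move=> ->; rewrite (bigD1 i)//= (bigD1 j) 1?eq_sym//= big1 ?mulr1; last first.
  by move=> k /andP[ki kj]; rewrite /C (negPf ki) (negPf kj) preimage_setT.
by rewrite /C !eqxx eq_sym (negPf ij) EFinM !fineK// mP.
Qed.

(** The error at one point of the square; its integral over the square bounds the error of the
    estimator. *)
Let err h w p : R :=
  `|Num.max (1 - kde K h (fun i => X i w) p) 0 - Num.max (1 - c p) 0|.

Lemma kde_ge0 h w p : 0 <= kde K h (fun i => X i w) p.
Proof.
apply: mulr_ge0; first by rewrite invr_ge0 mulr_ge0// sqr_ge0.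
by apply: sumr_ge0 => i _; exact: kernel2_ge0.
Qed.

Let err_ge0 h w p : 0 <= err h w p.
Proof. exact: normr_ge0. Qed.

Lemma err_le1 h w p : err h w p <= 1.
Proof.
have := kde_ge0 h w p; have := c_ge0 p; rewrite /err ler_norml.
by case: (leP (1 - kde _ _ _ _) 0); case: (leP (1 - c p) 0) => *; apply/andP; split; lra.
Qed.

Lemma measurable_kernel2_sample h i :
  measurable_fun setT (fun z : T * (R * R) => kernel2 R K h z.2 (X i z.1)).
Proof.
have mXi : measurable_fun setT (fun z : T * (R * R) => X i z.1).
  by apply: measurableT_comp => //; exact: mX.
apply: measurable_funM; apply: measurableT_comp => //; apply: measurable_funM => //;
  apply: measurable_funB.
- exact: (measurableT_comp measurable_fst measurable_snd).
- exact: (measurableT_comp measurable_fst mXi).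
- exact: (measurableT_comp measurable_snd measurable_snd).
- exact: (measurableT_comp measurable_snd mXi).
Qed.

Lemma measurable_kde h :
  measurable_fun setT (fun z : T * (R * R) => kde K h (fun i => X i z.1) z.2).
Proof.
apply: measurable_funM => //; apply: measurable_sum => i.
exact: measurable_kernel2_sample.
Qed.

Lemma measurable_err h : measurable_fun setT (fun z : T * (R * R) => err h z.1 z.2).
Proof.
apply: measurableT_comp => //; apply: measurable_funB; apply: measurable_maxr => //;
  apply: measurable_funB => //; first exact: measurable_kde.
exact: (measurableT_comp mc).
Qed.

Lemma measurable_sum_kernel2_sqr h : measurable_fun setT
  (fun z : T * (R * R) => \sum_(i < n) kernel2 R K h z.2 (X i z.1) ^+ 2).
Proof.
apply: measurable_sum => i; apply: measurable_funX.
exact: measurable_kernel2_sample.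
Qed.

(** Its expectation bounds the variance of the kernel sum at [p]. The dependence on both [w] and [p]
    is kept so that the order of integration can be exchanged later. *)
Let sumsq h w p : R := \sum_(i < n) kernel2 R K h p (X i w) ^+ 2.

Let sumsq_ge0 h w p : 0 <= sumsq h w p.
Proof. by apply: sumr_ge0 => i _; exact: sqr_ge0. Qed.

(** Near the boundary the trivial bound 1 is absorbed by [border]. Inside, the error is at most the
    bias plus the deviation of the estimator from its mean, which AM-GM replaces by its square. The
    weight [t] stays free, to be chosen independently of [p]. *)
Lemma expected_err_le h t p : 0 < h -> 2 * M1 * h < M - 1 -> 0 < t -> unit_sq p ->
  (\int[P]_w (err h w p)%:E <=
   (border R h p + (2 * M1 * h + (2 * t)^-1))%:E +
   (t / 2 * (n%:R * h ^+ 2) ^- 2)%:E * \int[P]_w (sumsq h w p)%:E)%E.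
Proof.
move=> h0 hM t0 Up.
set e := 2 * M1 * h; set a := t / 2 * (n%:R * h ^+ 2) ^- 2.
have e0 : 0 <= e by rewrite !mulr_ge0// ltW.
have nh0 : 0 < n%:R * h ^+ 2 by rewrite mulr_gt0 ?exprn_gt0// ltr0n.
have a0 : 0 <= a by rewrite mulr_ge0 ?divr_ge0 ?invr_ge0 ?exprn_ge0 ?ltW.
have s0 : 0 <= (2 * t)^-1 by rewrite invr_ge0 mulr_ge0 ?ltW.
have bd0 := border_ge0 R h p.
have Esum0 : (0 <= \int[P]_w (sumsq h w p)%:E)%E.
  by apply: integral_ge0 => w _; rewrite lee_fin.
have merr : measurable_fun setT (fun w => err h w p).
  exact: (measurableT_comp (measurable_err h) (pair2_measurable p)).
have mker i : measurable_fun setT (fun w => kernel2 R K h p (X i w)).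
  exact: (measurableT_comp (measurable_kernel2_sample h i) (pair2_measurable p)).
have Ecst (r : R) : (\int[P]_w (cst r%:E w) = r%:E)%E.
  rewrite integral_cst// -[RHS]mule1; congr (_ * _)%E; exact: probability_setT.
have [[p1 p2]|/(border_ge1 R h p Up) bd1] :=
    pselect (h < p.1 < 1 - h /\ h < p.2 < 1 - h); last first.
  apply: (@le_trans _ _ 1%E).
    rewrite -[leRHS]Ecst; apply: ge0_le_integral => //.
    - by move=> w _; rewrite lee_fin.
    - exact/measurable_EFinP.
    - by move=> w _; rewrite lee_fin err_le1.
  rewrite -[1%E]adde0; apply: leeD; last by rewrite mule_ge0.
  by rewrite lee_fin (le_trans bd1)// lerDl addr_ge0.
have [b Kb] : exists b, forall x, K x <= b by have [_ [_ []]] := K_ok.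
have b0 : 0 <= b by rewrite (le_trans (K_ge0 0)).
pose i0 := Ordinal n_gt0.
(* The mean is finite because the product kernel is at most [b * b], so [fine] loses nothing. *)
pose m := fine (\int[P]_w (kernel2 R K h p (X i0 w))%:E)%E.
have Em i : (\int[P]_w (kernel2 R K h p (X i w))%:E = m%:E)%E.
  rewrite integral_kernel2_sample -(integral_kernel2_sample h p i0) fineK//.
  rewrite ge0_fin_numE; last by apply: integral_ge0 => w _; rewrite lee_fin kernel2_ge0.
  apply: (@le_lt_trans _ _ (\int[P]_w (cst (b * b)%:E w))%E).
    apply: ge0_le_integral => //.
    - by move=> w _; rewrite lee_fin kernel2_ge0.
    - exact/measurable_EFinP.
    - by move=> w _; rewrite lee_fin ler_pM.
  by rewrite Ecst ltry.
(* [m / h ^ 2] is the mean of the estimator at [p]. *)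
have bias : `|Num.max (1 - m / h ^+ 2) 0 - Num.max (1 - c p) 0| <= e.
  apply: (bias_bound _ _ _ _ M1_gt0 cC M_gt1 K _ _ h0 hM K_ok p1 p2).
  rewrite -(integral_kernel2_sample h p i0) Em; congr EFin.
  by rewrite mulrC divfK// expf_neq0// gt_eqF.
have err_le w : err h w p <=
    e + (2 * t)^-1 + a * (\sum_(i < n) kernel2 R K h p (X i w) - n%:R * m) ^+ 2.
  set S := \sum_(i < n) _; set k := kde K h (fun i => X i w) p.
  pose x := k - m / h ^+ 2.
  (* The factor [a] includes the normalisation [(n h ^ 2) ^ -2], which turns the centred kernel sum
     into the deviation [x] of the estimator. *)
  have xE : a * (S - n%:R * m) ^+ 2 = t / 2 * x ^+ 2.
    rewrite /x (_ : k = (n%:R * h ^+ 2)^-1 * S)// /a; field.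
    by rewrite (gt_eqF h0) pnatr_eq0 -lt0n n_gt0.
  (* The mean is inserted between estimate and density, and [(1 - x)_+] is 1-Lipschitz. *)
  have : err h w p <= `|x| + e.
    apply: le_trans (ler_distD (Num.max (1 - m / h ^+ 2) 0) _ _) _.
    apply: lerD _ bias.
    rewrite /x; case: (leP (1 - k) 0); case: (leP (1 - m / h ^+ 2) 0) => u v;
      by rewrite ?subrr ?subr0 ?sub0r// ler_norml; have := ler_norm (k - m / h ^+ 2);
        have := ler_norm (- (k - m / h ^+ 2)); rewrite normrN => ? ?; apply/andP; split; lra.
  move=> /le_trans; apply; rewrite xE.
  (* AM-GM: [2 |x| <= t x^2 + 1 / t] *)
  have : 0 <= (t * `|x| - 1) ^+ 2 / (2 * t) by rewrite divr_ge0 ?sqr_ge0 ?mulr_ge0 ?ltW.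
  rewrite -[x ^+ 2]real_normK ?num_real//.
  rewrite (_ : _ / (2 * t) = t / 2 * `|x| ^+ 2 - `|x| + (2 * t)^-1); last first.
    by field; rewrite gt_eqF.
  by move=> ?; lra.
apply: (@le_trans _ _ (\int[P]_w (cst (e + (2 * t)^-1)%:E w +
    a%:E * ((\sum_(i < n) kernel2 R K h p (X i w) - n%:R * m) ^+ 2)%:E))%E).
  apply: ge0_le_integral => //.
  - by move=> w _; rewrite lee_fin.
  - exact/measurable_EFinP.
  - apply: emeasurable_funD => //; apply: measurable_funeM; apply/measurable_EFinP.
    by apply: measurable_funX; apply: measurable_funB => //; apply: measurable_sum.
  - by move=> w _; rewrite -EFinM -EFinD lee_fin.
have mS : measurable_fun setT
    (fun w => ((\sum_(i < n) kernel2 R K h p (X i w) - n%:R * m) ^+ 2)%:E).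
  apply/measurable_EFinP; apply: measurable_funX; apply: measurable_funB => //.
  by apply: measurable_sum.
rewrite ge0_integralD//; last 3 first.
- by move=> w _; rewrite lee_fin addr_ge0.
- by move=> w _; rewrite mule_ge0// lee_fin ?sqr_ge0.
- exact: measurable_funeM.
rewrite Ecst ge0_integralZl_EFin//; last first.
  by move=> w _; rewrite lee_fin sqr_ge0.
apply: leeD; first by rewrite lee_fin lerDr.
apply: lee_wpmul2l; first by rewrite lee_fin.
apply: le_trans (integral_sum_centered_sqr_le _ _ _ _ _ P n X (kernel2 R K h p) m
  n_gt0 mX sample_pairwise_indep _ (kernel2_ge0 h p) Em) _.
  exact: measurable_kernel2l.
rewrite -ge0_integral_sum//; last 2 first.
- by move=> i; apply/measurable_EFinP; exact: measurable_funX.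
- by move=> i w _; rewrite lee_fin sqr_ge0.
by under eq_integral do rewrite sumEFin.
Qed.

(** The pointwise bound is integrated over the square: [border] yields [4 h], and the sum of squares
    yields at most [n (2 b ^ 2 h) ^ 2], which after multiplication by [a] is the last term. *)
Lemma risk_le h t b : 0 < h -> 2 * M1 * h < M - 1 -> 0 < t -> (forall x, K x <= b) ->
  (\int[P]_w `|Ccor_hat K h (fun i => X i w) - Ccor c| <=
   (4 * h + 2 * M1 * h + (2 * t)^-1 + 2 * t * b ^+ 4 / (n%:R * h ^+ 2))%:E)%E.
Proof.
move=> h0 hM t0 Kb.
set e := 2 * M1 * h; set a := t / 2 * (n%:R * h ^+ 2) ^- 2.
have e0 : 0 <= e by rewrite !mulr_ge0// ltW.
have nh0 : 0 < n%:R * h ^+ 2 by rewrite mulr_gt0 ?exprn_gt0// ltr0n.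
have a0 : 0 <= a by rewrite mulr_ge0 ?divr_ge0 ?invr_ge0 ?exprn_ge0 ?ltW.
have s0 : 0 <= (2 * t)^-1 by rewrite invr_ge0 mulr_ge0 ?ltW.
have mU := measurable_unit_sq R.
have mF := measurable_err h; have mS := measurable_sum_kernel2_sqr h.
have mES : measurable_fun setT (fun p => \int[P]_w (sumsq h w p)%:E)%E.
  apply: (measurable_fun_fubini_tonelli_G (m1 := P) (fun z : T * (R * R) => (sumsq h z.1 z.2)%:E)).
    exact/measurable_EFinP.
  by move=> z; rewrite lee_fin.
have mEF : measurable_fun setT (fun p => \int[P]_w (err h w p)%:E)%E.
  apply: (measurable_fun_fubini_tonelli_G (m1 := P) (fun z : T * (R * R) => (err h z.1 z.2)%:E)).
    exact/measurable_EFinP.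
  by move=> z; rewrite lee_fin.
have ES0 p : (0 <= \int[P]_w (sumsq h w p)%:E)%E.
  by apply: integral_ge0 => w _; rewrite lee_fin.
have merr w : measurable_fun setT (fun p => err h w p).
  exact: (measurableT_comp mF (pair1_measurable w)).
have mkdew w : measurable_fun setT (fun p => kde K h (fun i => X i w) p).
  exact: (measurableT_comp (measurable_kde h) (pair1_measurable w)).
have kde0 := kde_ge0 h.
(* Truncated functions take values in [[0, 1]] on a square of measure 1; this integrability allows
   the two integrals in the error to be subtracted. *)
have bint (f : R * R -> R) : measurable_fun setT f -> (forall p, 0 <= f p) ->
    leb2.-integrable unit_sq (EFin \o (fun p => Num.max (1 - f p) 0)).
  move=> mf f0; apply: measurable_bounded_integrable => //.
  - exact: (eq_ind_r (fun x => x < +oo)%E (ltry 1) (leb2_unit_sq R)).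
  - by apply: measurable_funTS; apply: measurable_maxr => //; apply: measurable_funB.
  - exists 1; split=> // y y1 p _ /=; apply: le_trans (ltW y1); rewrite ger0_norm.
      by rewrite ge_max ler01 andbT gerBl.
    by rewrite le_max lexx orbT.
have path_le w : (`|Ccor_hat K h (fun i => X i w) - Ccor c| <=
    \int[leb2]_(p in unit_sq) (err h w p)%:E)%E.
  rewrite /Ccor_hat (Ccor_integral_max _ c (proj1 cC)) -integralB_EFin//; last 2 first.
  - exact: bint (mkdew w) (kde0 w).
  - exact: bint mc c_ge0.
  under eq_integral do rewrite -EFinB.
  apply: le_trans (le_abse_integral _ _ _) _ => //.
  apply/measurable_EFinP; apply: measurable_funTS; apply: measurable_funB;
    apply: measurable_maxr => //; apply: measurable_funB => //.
  exact: mkdew.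
apply: (@le_trans _ _ (\int[P]_w \int[leb2]_(p in unit_sq) (err h w p)%:E)%E).
  apply: ge0_le_integral => //.
  - apply: measurableT_comp => //; apply: emeasurable_funB => //.
    apply: (measurable_integral_unit_sq R d T
      (fun z => Num.max (1 - kde K h (fun i => X i z.1) z.2) 0)).
      by apply: measurable_maxr => //; apply: measurable_funB => //; exact: measurable_kde.
    by move=> z; rewrite le_max lexx orbT.
  - by apply: (measurable_integral_unit_sq R d T (fun z => err h z.1 z.2)) => // z.
rewrite (tonelli_unit_sq R d T (fun z => err h z.1 z.2))//=.
have mB : measurable_fun unit_sq (fun p => (border R h p + (e + (2 * t)^-1))%:E).
  by apply/measurable_EFinP; apply: measurable_funTS; apply: measurable_funD => //;
    exact: measurable_border.
have B0 p : 0 <= border R h p + (e + (2 * t)^-1) by rewrite !addr_ge0// border_ge0.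
apply: (@le_trans _ _ (\int[leb2]_(p in unit_sq)
    ((border R h p + (e + (2 * t)^-1))%:E + a%:E * \int[P]_w (sumsq h w p)%:E))%E).
  apply: ge0_le_integral => //.
  - by move=> p _; apply: integral_ge0 => w _; rewrite lee_fin.
  - exact: measurable_funTS.
  - by apply: emeasurable_funD => //; apply: measurable_funeM; exact: measurable_funTS.
  - by move=> p Up; exact: expected_err_le.
rewrite ge0_integralD//; last 3 first.
- by move=> p _; rewrite lee_fin.
- by move=> p _; rewrite mule_ge0.
- by apply: measurable_funeM; exact: measurable_funTS.
rewrite ge0_integralZl_EFin//; last exact: measurable_funTS.
have border_le : (\int[leb2]_(p in unit_sq) (border R h p + (e + (2 * t)^-1))%:E <=
    (4 * h + (e + (2 * t)^-1))%:E)%E.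
  under eq_integral do rewrite EFinD.
  rewrite [leRHS]EFinD ge0_integralD//; last 3 first.
  - by move=> p _; rewrite lee_fin border_ge0.
  - by apply/measurable_EFinP; apply: measurable_funTS; exact: measurable_border.
  - by move=> p _; rewrite lee_fin addr_ge0.
  apply: leeD; first by apply: integral_border; exact: ltW.
  by rewrite integral_cst// -[leRHS]mule1; apply: lee_wpmul2l;
    [rewrite lee_fin addr_ge0|exact: (eq_ind_r (fun x => x <= 1)%E (lexx 1%E) (leb2_unit_sq R))].
have sumsq_le : (\int[leb2]_(p in unit_sq) \int[P]_w (sumsq h w p)%:E <=
    (n%:R * (2 * b ^+ 2 * h) ^+ 2)%:E)%E.
  (* Exchanging back puts the integral over [p] inside, with the sample fixed; extended to the whole
     plane, it is bounded for every sample. *)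
  rewrite -(tonelli_unit_sq R d T (fun z => sumsq h z.1 z.2))//=.
  apply: (@le_trans _ _ (\int[P]_w (cst (n%:R * (2 * b ^+ 2 * h) ^+ 2)%:E w))%E); last first.
    rewrite integral_cst// -[leRHS]mule1; apply: lee_wpmul2l.
      by rewrite lee_fin mulr_ge0// sqr_ge0.
    exact: probability_le1.
  apply: ge0_le_integral => //.
  - by move=> w _; apply: integral_ge0 => p _; rewrite lee_fin.
  - by apply: (measurable_integral_unit_sq R d T (fun z => sumsq h z.1 z.2)) => // z.
  move=> w _.
  have mker i : measurable_fun setT (fun p => kernel2 R K h p (X i w)).
    exact: (measurableT_comp (measurable_kernel2_sample h i) (pair1_measurable w)).
  apply: (@le_trans _ _ (\int[leb2]_p (sumsq h w p)%:E)%E).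
    apply: ge0_subset_integral => //.
    - apply/measurable_EFinP; apply: measurable_sum => i; apply: measurable_funX.
      exact: mker.
    - by move=> p _; rewrite lee_fin.
  rewrite /sumsq; under eq_integral do rewrite -sumEFin.
  rewrite ge0_integral_sum//; last 2 first.
  - by move=> i; apply/measurable_EFinP; apply: measurable_funX; exact: mker.
  - by move=> i p _; rewrite lee_fin sqr_ge0.
  rewrite mulr_natl -[X in _ *+ X](card_ord n) -sumr_const -sumEFin.
  by apply: lee_sum => i _; exact: integral_kernel2_sqr_le.
apply: (le_trans (leeD border_le (lee_wpmul2l _ sumsq_le))); first by rewrite lee_fin.
rewrite -EFinM -EFinD lee_fin le_eqVlt; apply/orP; left; apply/eqP.
by rewrite /a; field; rewrite !gt_eqF// ltr0n.
Qed.

End risk.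

(** * The uniform bound, consistency and the rate *)

Section uniform_risk.
Variables (R : realType) (M M1 : R) (K : R -> R).

Lemma unif_risk_le_trans n h (r s : R) :
  r <= s -> unif_risk_le M M1 K n h r -> unif_risk_le M M1 K n h s.
Proof.
move=> rs risk c cC d T P X Xc; apply: le_trans (risk c cC d T P X Xc) _.
by rewrite lee_fin.
Qed.

(** The limit on [h] keeps [2 M1 h] at most [(M - 1) / 2], hence strictly below [M - 1]. *)
Lemma unif_risk_bound (b : R) n h : 1 < M -> 0 < M1 -> kernel_ok K ->
  0 < b -> (forall x, K x <= b) -> (0 < n)%N -> 0 < h <= (M - 1) / (4 * M1) ->
  unif_risk_le M M1 K n h ((4 + 2 * M1) * h +
    2 * b ^+ 2 / Num.sqrt (n%:R * h ^+ 2) + 1 / (n%:R * h ^+ 2)).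
Proof.
move=> M_gt1 M1_gt0 K_ok b0 Kb n0 /andP[h0 hle] c cC d T P X Xc.
have nh0 : 0 < n%:R * h ^+ 2 by rewrite mulr_gt0 ?exprn_gt0// ltr0n.
set N := Num.sqrt _; have N0 : 0 < N by rewrite sqrtr_gt0.
have N2 : n%:R * h ^+ 2 = N ^+ 2 by rewrite sqr_sqrtr// ltW.
have hM : 2 * M1 * h < M - 1.
  by move: hle; rewrite ler_pdivlMr ?mulr_gt0// => ?; nra.
(* [t] balances the two terms [1 / (2 t)] and [2 t b^4 / (n h^2)] *)
pose t := N / (2 * b ^+ 2).
have t0 : 0 < t by rewrite divr_gt0 ?mulr_gt0 ?exprn_gt0.
apply: le_trans (risk_le _ _ _ _ _ M_gt1 M1_gt0 K_ok cC _ _ P n X n0 Xc h t b h0 hM t0 Kb) _.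
(* With this [t] both balanced terms equal [b ^ 2 / N], so the two bounds differ by exactly
   [1 / N ^ 2]. *)
rewrite lee_fin N2 -subr_ge0 (_ : _ - _ = 1 / N ^+ 2); first by rewrite divr_ge0// sqr_ge0.
by rewrite /t; field; rewrite !gt_eqF.
Qed.

End uniform_risk.

Theorem theorem2 (R : realType) (M M1 : R) (K : R -> R) :
  1 < M -> 0 < M1 -> kernel_ok K ->
  exists A B M5 h0 : R, [/\ 0 < A, 0 < B, 0 < M5 & 0 < h0] /\
    (* main uniform risk bound *)
    (forall (n : nat) (h : R), (0 < n)%N -> 0 < h <= h0 ->
       unif_risk_le M M1 K n h
         (A * h + B / Num.sqrt (n%:R * h ^+ 2) + M5 / (n%:R * h ^+ 2))) /\
    (* uniform consistency *)
    (forall hs : nat -> R, (forall n, 0 < hs n) ->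
       hs @ \oo --> 0 ->
       (fun n => n%:R * hs n ^+ 2) @ \oo --> +oo ->
       forall eps : R, 0 < eps ->
       \forall n \near \oo, unif_risk_le M M1 K n (hs n) eps) /\
    (* rate with h = n^(-1/4) *)
    (exists C0 : R, 0 < C0 /\
       \forall n \near \oo,
         unif_risk_le M M1 K n (n%:R `^ (- (1 / 4)))
           (C0 * n%:R `^ (- (1 / 4)))).
Proof.
move=> M_gt1 M1_gt0 K_ok.
(* The maximum with 1 makes the bound positive, as the choice of [t] divides by [b ^ 2]. *)
have [b [b0 Kb]] : exists b, 0 < b /\ forall x, K x <= b.
  have [_ [_ [[b Kb] _]]] := K_ok; exists (Num.max b 1).
  by split=> [|x]; rewrite ?lt_max ?ltr01 ?orbT// le_max Kb.
pose A := 4 + 2 * M1; pose B := 2 * b ^+ 2; pose h0 := (M - 1) / (4 * M1).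
have A0 : 0 < A by rewrite addr_gt0 ?mulr_gt0.
have B0 : 0 < B by rewrite mulr_gt0 ?exprn_gt0.
have h00 : 0 < h0 by rewrite divr_gt0 ?mulr_gt0 ?subr_gt0.
have main n h := @unif_risk_bound R M M1 K b n h M_gt1 M1_gt0 K_ok b0 Kb.
exists A, B, 1, h0; split=> //; split=> //; split.
  move=> hs hs0 hs_cvg nhs_cvg eps eps0.
  (* Each of the three terms is to be at most [eps / 3]; [h1] settles the first and keeps the
     bandwidth below [h0]. *)
  pose h1 := Num.min h0 (eps / (3 * A)).
  have h10 : 0 < h1 by rewrite lt_min h00 divr_gt0 ?mulr_gt0.
  near=> n.
  have n0 : (0 < n)%N by near: n; exact: nbhs_infty_gt.
  have : hs n < h1 by near: n; exact: (cvgr_lt _ hs_cvg).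
  rewrite lt_min => /andP[hn hnA].
  (* The threshold is squared because the second term contains the square root of [n h ^ 2]. *)
  have nh1 : (3 * B / eps) ^+ 2 <= n%:R * hs n ^+ 2.
    by near: n; move/cvgryPge : nhs_cvg; apply.
  have nh2 : 3 / eps <= n%:R * hs n ^+ 2.
    by near: n; move/cvgryPge : nhs_cvg; apply.
  apply: unif_risk_le_trans (main n (hs n) n0 _); last by rewrite hs0 ltW.
  have nh0 : 0 < n%:R * hs n ^+ 2 by rewrite mulr_gt0 ?exprn_gt0// ltr0n.
  have e1 : A * hs n <= eps / 3.
    by move: (ltW hnA); rewrite !ler_pdivlMr ?mulr_gt0// => ?; lra.
  have e2 : B / Num.sqrt (n%:R * hs n ^+ 2) <= eps / 3.
    set N := Num.sqrt _; have N0 : 0 < N by rewrite sqrtr_gt0.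
    have : 3 * B / eps <= N.
      rewrite -(@ler_pXn2r _ 2) ?nnegrE ?(ltW N0)//; last by rewrite divr_ge0 ?mulr_ge0 ?ltW.
      by rewrite sqr_sqrtr// ltW.
    by rewrite ler_pdivrMr// ler_pdivrMr// => ?; lra.
  have e3 : 1 / (n%:R * hs n ^+ 2) <= eps / 3.
    have : 3 <= n%:R * hs n ^+ 2 * eps by rewrite -ler_pdivrMr.
    by rewrite ler_pdivrMr// => ?; lra.
  by rewrite -/A -/B; lra.
(* With [x = n ^ (1/4)] the bound reads [A / x + B / x + 1 / x ^ 2], and [1 / x ^ 2 <= 1 / x] once
   [x >= 1]. *)
exists (A + B + 1); split; first exact: addr_gt0 (addr_gt0 A0 B0) ltr01.
near=> n.
have n0 : (0 < n)%N by near: n; exact: nbhs_infty_gt.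
set h := _ `^ _; pose x : R := n%:R `^ (1 / 4).
have nR0 : 0 < n%:R :> R by rewrite ltr0n.
have x0 : 0 < x by rewrite powR_gt0.
have hE : h = x^-1 by rewrite /h powRN.
have x4 : x ^+ 4 = n%:R.
  by rewrite -powR_mulrn ?ltW// -powRrM mul1r mulVf ?pnatr_eq0// powRr1// ltW.
have x1 : 1 <= x by rewrite -(@ler_pXn2r _ 4) ?nnegrE ?(ltW x0)// expr1n x4 ler1n.
(* This is the admissibility [h <= h0], which holds as soon as [n] is at least the fourth power of
   [1 / h0]. *)
have xh0 : h0^-1 <= x.
  rewrite -(@ler_pXn2r _ 4) ?nnegrE ?invr_ge0 ?(ltW x0) ?(ltW h00)// x4.
  by near: n; exact: nbhs_infty_ger.
have nh : n%:R * h ^+ 2 = x ^+ 2 by rewrite hE -x4; field; rewrite gt_eqF.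
apply: unif_risk_le_trans (main n h n0 _); last first.
  by rewrite {1}hE invr_gt0 x0 -/h0 hE -[h0]invrK lef_pV2 ?posrE ?invr_gt0.
have x2 : (x ^+ 2)^-1 <= x^-1.
  by rewrite lef_pV2 ?posrE ?exprn_gt0// expr2 ler_peMl// ltW.
rewrite nh sqrtr_sqr gtr0_norm// -/A -/B hE div1r.
by rewrite !(mulrDl _ _ x^-1) mul1r lerD2l.
Unshelve. all: by end_near.
Qed.
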